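(* Let $G$ be an infinite, locally finite, connected simple graph with a fixed vertex $a$. The only isometric multiplication operators $M_\psi$ on $\hat{\mathcal{L}}$ or on $\hat{\mathcal{L}}_0$ are those for which $\psi:G\to\mathbb{C}$ is constant of modulus one. That is, for $X=\hat{\mathcal{L}}$ or $X=\hat{\mathcal{L}}_0$, a multiplication operator $M_\psi:X\to X$ satisfies $\|M_\psi f\|_{\hat{\mathcal{L}}}^{a}=\|f\|_{\hat{\mathcal{L}}}^{a}$ for all $f\in X$ if and only if there is $\lambda\in\mathbb{C}$ with $|\lambda|=1$ such that $\psi(v)=\lambda$ for all $v\in G$.
   Context: A graph is always connected, undirected, simple, with infinitely many vertices, each of finite degree; $G$ also denotes its vertex set, $v\sim w$ means $v$ and $w$ are adjacent, $N_v=\{w\in G: w\sim v\}$, and $d$ is the graph distance. The Lipschitz space is $\hat{\mathcal{L}}=\{f:G\to\mathbb{C} : \sup_{v\sim w}|f(v)-f(w)|<\infty\}$ with norm $\|f\|_{\hat{\mathcal{L}}}^{a}:=|f(a)|+\sup_{v\sim w}|f(v)-f(w)|$. The little Lipschitz space $\hat{\mathcal{L}}_0$, with the same norm, is the set of $f\in\hat{\mathcal{L}}$ with $\lim_{d(a,v)\to\infty}\max_{w\in N_v}|f(v)-f(w)|=0$ (for every $\epsilon>0$ there is $N\in\mathbb{N}$ with $\max_{w\in N_v}|f(v)-f(w)|<\epsilon$ whenever $d(a,v)>N$). For $\psi:G\to\mathbb{C}$ with $\psi f\in X$ for all $f\in X$, the multiplication operator $M_\psi:X\to X$ is $M_\psi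 f=\psi f$. *)

(* Defs.v *)
From HB Require Import structures.
From mathcomp Require Import all_boot all_order all_algebra.
From mathcomp Require Import all_classical all_reals all_analysis.
From mathcomp Require Import complex.
Set Implicit Arguments.
Unset Strict Implicit.
Unset Printing Implicit Defensive.
Import Order.TTheory GRing.Theory Num.Theory.
Import numFieldNormedType.Exports.
Local Open Scope classical_set_scope.
Local Open Scope complex_scope.
Local Open Scope ring_scope.

(* [adj_connected]: [v :: p] is a walk from [v] to [w]; its length is [size p] *)
Record graph := Graph {
  vertex :> Type;
  adj : rel vertex;
  adj_sym : symmetric adj;
  adj_irr : irreflexive adj;
  adj_connected : forall v w, exists p, path adj v p /\ last v p = w;
  vertex_infinite : infinite_set [set: vertex];
  adj_locally_finite : forall v, finite_set [set w | adj v w]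
}.

Definition neighbours (G : graph) (v : G) : set G := [set w | adj w v].

Definition has_walk (G : graph) (v w : G) (n : nat) : Prop :=
  exists p, [/\ path (@adj G) v p, last v p = w & size p = n].

Lemma exists_has_walk (G : graph) (v w : G) : exists n, `[< has_walk v w n >].
Proof.
by have [p [vp pw]] := adj_connected v w; exists (size p); apply/asboolP; exists p.
Qed.

Definition graph_dist (G : graph) (v w : G) : nat := ex_minn (exists_has_walk v w).

Section spaces.
Context {R : realType} {G : graph}.
Implicit Types f psi : G -> R[i].

(* [Normc.normc] is the R-valued modulus; [`|z|] on R[i] is R[i]-valued. *)
Definition lip_const f : \bar R :=
  ereal_sup [set (Normc.normc (f e.1 - f e.2))%:E | e in [set e : G * G | adj e.1 e.2]].

Definition lip_space : set (G -> R[i]) := [set f | (lip_const f < +oo)%E].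

(* Finite exactly on [lip_space]. *)
Definition lip_norm (a : G) f : \bar R := ((Normc.normc (f a))%:E + lip_const f)%E.

(* The supremum is a maximum: [neighbours v] is finite and nonempty. *)
Definition max_diff f (v : G) : R :=
  sup [set Normc.normc (f v - f w) | w in neighbours v].

Definition little_lip_space (a : G) : set (G -> R[i]) :=
  [set f | lip_space f /\
    forall eps : R, 0 < eps ->
      exists N : nat, forall v : G, (N < graph_dist a v)%N -> max_diff f v < eps].

Definition mult_op psi f : G -> R[i] := fun v => psi v * f v.

End spaces.

(* Main.v *)
Require Import Defs.
From mathcomp Require Import all_boot all_order all_algebra.
From mathcomp Require Import all_classical all_reals all_analysis.
From mathcomp Require Import complex.
From mathcomp Require Import lra.
Set Implicit Arguments.
Unset Strict Implicit.
Unset Printing Implicit Defensive.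
Import Order.TTheory GRing.Theory Num.Theory.
Import numFieldNormedType.Exports.
Local Open Scope classical_set_scope.
Local Open Scope complex_scope.
Local Open Scope ring_scope.

(** Testing the isometry on two kinds of functions suffices.  The indicator of
    a vertex [v] has Lipschitz constant 1, because [v] has a neighbour, and
    [M_psi] multiplies it by the scalar [psi v]; comparing norms
    ([lip_norm_spike]) gives [|psi v| = 1].  In particular [|psi a| = 1], so
    that the constant function 1, whose norm is 1 and whose image is [psi],
    forces the Lipschitz constant of [psi] to vanish; as the graph is
    connected, [psi] is constant.  Both kinds of test functions have zero
    differences far from [a], hence lie in the little Lipschitz space as well
    ([little_lip_spike], [little_lip_cst]), and one argument serves both
    spaces.  Conversely, a factor of modulus one leaves every modulus entering
    the norm unchanged. *)

Section graphs.
Context {G : graph}.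

Lemma graph_dist_le (v w : G) n : has_walk v w n -> (graph_dist v w <= n)%N.
Proof.
by rewrite /graph_dist => vwn; case: ex_minnP => m _; apply; apply/asboolP.
Qed.

Lemma has_walk_dist (v w : G) : has_walk v w (graph_dist v w).
Proof. by rewrite /graph_dist; case: ex_minnP => m /asboolP. Qed.

Lemma graph_dist_adj (a v w : G) :
  adj v w -> (graph_dist a w <= (graph_dist a v).+1)%N.
Proof.
move=> vw; have [p [ap pv sp]] := has_walk_dist a v.
apply: graph_dist_le; exists (rcons p w).
by rewrite rcons_path last_rcons size_rcons ap pv vw sp.
Qed.

(** In an infinite graph some vertex differs from [v], and a walk to it starts
    with a neighbour of [v]. *)
Lemma exists_adj (v : G) : exists w, adj v w.
Proof.
have [w wv] : exists w : G, w <> v.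
  apply: contrapT => /forallNP all_v; apply: (@vertex_infinite G).
  apply: (@sub_finite_set _ _ [set v]) => // w _.
  exact: contrapT (all_v w).
have [[|u p] /= [vp pw]] := adj_connected v w; first by case: wv.
by exists u; case/andP: vp.
Qed.

Lemma adj_invariant_cst (T : Type) (f : G -> T) :
  (forall v w, adj v w -> f v = f w) -> forall v w, f v = f w.
Proof.
move=> fE v w; have [p [vp <-]] := adj_connected v w.
by elim: p v vp => //= u p IHp v /andP[/fE -> /IHp].
Qed.

End graphs.

Section lipschitz.
Context {R : realType} {G : graph}.
Implicit Types (f psi : G -> R[i]) (a v w : G) (c : R[i]).

Lemma normc_ge0 c : 0 <= Normc.normc c.
Proof. by case: c => x y; exact: sqrtr_ge0. Qed.

Lemma normcN c : Normc.normc (- c) = Normc.normc c.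
Proof. by case: c => x y /=; rewrite !sqrrN. Qed.

Lemma lip_const_ge f v w :
  adj v w -> ((Normc.normc (f v - f w))%:E <= lip_const f)%E.
Proof. by move=> vw; apply: ereal_sup_ubound; exists (v, w). Qed.

Lemma lip_const_le f (M : \bar R) :
  (forall v w, adj v w -> ((Normc.normc (f v - f w))%:E <= M)%E) ->
  (lip_const f <= M)%E.
Proof. by move=> fM; apply: ge_ereal_sup => _ [[v w] /= vw <-]; exact: fM. Qed.

Lemma lip_const_cst a c : lip_const (fun _ : G => c) = 0%E.
Proof.
apply/eqP; rewrite eq_le; apply/andP; split.
  by apply: lip_const_le => v w _; rewrite subrr Normc.normc0.
have [w aw] := exists_adj a.
by apply: le_trans (lip_const_ge _ aw); rewrite subrr Normc.normc0.
Qed.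

Definition spike v c : G -> R[i] := fun w => if `[< w = v >] then c else 0.

Lemma spikeE v c : spike v c v = c.
Proof. by rewrite /spike asboolT. Qed.

Lemma spike_neq v w c : w <> v -> spike v c w = 0.
Proof. by move=> wv; rewrite /spike asboolF. Qed.

Lemma mult_op_spike psi v c : mult_op psi (spike v c) = spike v (psi v * c).
Proof.
apply/funext => w; rewrite /mult_op /spike.
by case: asboolP => [->//|_]; rewrite mulr0.
Qed.

(** The supremum is attained on any edge at [v]; an edge has distinct ends, so
    no difference involves the spike twice. *)
Lemma lip_const_spike v c : lip_const (spike v c) = (Normc.normc c)%:E.
Proof.
apply/eqP; rewrite eq_le; apply/andP; split.
  apply: lip_const_le => w u wu; rewrite lee_fin /spike.
  by do 2 case: asboolP => _;
    rewrite ?subrr ?subr0 ?sub0r ?normcN ?Normc.normc0 ?normc_ge0.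
have [w vw] := exists_adj v.
have wv : w <> v by move=> wv; move: vw; rewrite wv adj_irr.
by have := lip_const_ge (spike v c) vw; rewrite spikeE spike_neq// subr0.
Qed.

(** The base point contributes to the norm exactly when it carries the
    spike; either way the norm is a multiple of [|c|] by a positive factor that does
    not depend on [c], so that it determines [|c|]. *)
Lemma lip_norm_spike a v c :
  lip_norm a (spike v c) =
  ((if `[< a = v >] then 2 else 1) * Normc.normc c)%:E.
Proof.
rewrite /lip_norm lip_const_spike -EFinD /spike; case: asboolP => _.
  by rewrite mulr2n mulrDl mul1r.
by rewrite Normc.normc0 add0r mul1r.
Qed.

Lemma max_diff_eq0 f v :
  (forall w, adj w v -> f v = f w) -> max_diff f v = 0.
Proof.
move=> fE; rewrite /max_diff.
have sub0 : [set Normc.normc (f v - f w) | w in neighbours v] `<=` [set 0].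
  by move=> _ [w wv <-]; rewrite (fE w wv) subrr Normc.normc0.
by case/subset_set1: sub0 => ->; rewrite ?sup0 ?sup1.
Qed.

Lemma little_lip_cst a c : little_lip_space a (fun=> c).
Proof.
split; first by rewrite /lip_space /= (lip_const_cst a) ltry.
by move=> eps eps0; exists 0%N => v _; rewrite max_diff_eq0.
Qed.

(** Beyond distance [graph_dist a v + 1] from [a] no edge touches [v]. *)
Lemma little_lip_spike a v c : little_lip_space a (spike v c).
Proof.
split; first by rewrite /lip_space /= lip_const_spike ltry.
move=> eps eps0; exists (graph_dist a v).+1 => w vw; rewrite max_diff_eq0//.
move=> u uw; rewrite !spike_neq// => E.
  by move: (graph_dist_adj a uw); rewrite E leqNgt vw.
by move: vw; rewrite E ltnNge leqnSn.
Qed.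

Lemma lip_norm_unimodular a c f :
  Normc.normc c = 1 -> lip_norm a (mult_op (fun=> c) f) = lip_norm a f.
Proof.
move=> c1; rewrite /lip_norm /mult_op Normc.normcM c1 mul1r; congr (_ + _)%E.
rewrite /lip_const; congr ereal_sup; apply: eq_imagel => -[v w] _ /=.
by rewrite -mulrBr Normc.normcM c1 mul1r.
Qed.

(** The indicators make [psi] unimodular, in particular at [a]; then [psi],
    the image of the constant function 1, uses up the whole norm 1 at the base
    point, and nothing is left for its Lipschitz constant. *)
Lemma isometric_multiplier_cst a psi :
  (forall v, lip_norm a (mult_op psi (spike v 1)) = lip_norm a (spike v 1)) ->
  lip_norm a (mult_op psi (fun=> 1)) = lip_norm a (fun=> 1) ->
  exists c, Normc.normc c = 1 /\ forall v, psi v = c.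
Proof.
move=> isom_spike isom1.
have psi1 v : Normc.normc (psi v) = 1.
  move/eqP: (isom_spike v).
  rewrite mult_op_spike !lip_norm_spike mulr1 Normc.normc1 eqe => /eqP.
  by case: asboolP => _; lra.
have lip_psi : lip_const psi = 0%E.
  move: isom1; have -> : mult_op psi (fun=> 1) = psi.
    by apply/funext => v; rewrite /mult_op mulr1.
  rewrite /lip_norm (lip_const_cst a) psi1 Normc.normc1.
  by move=> /(congr1 (fun x => x - 1%:E)%E); rewrite ![(1%:E + _)%E]addeC !addeK.
exists (psi a); split=> // v; apply: adj_invariant_cst => {}v w vw.
apply/eqP; rewrite -subr_eq0; apply/eqP/Normc.eq0_normc/eqP.
rewrite eq_le normc_ge0 andbT -lee_fin -[leRHS]lip_psi.
exact: lip_const_ge.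
Qed.

End lipschitz.

Theorem proposition9p1 (R : realType) (G : graph) (a : G)
    (X : set (G -> R[i])) (hX : X = lip_space \/ X = little_lip_space a)
    (psi : G -> R[i]) (hpsi : forall f, X f -> X (mult_op psi f)) :
  (forall f, X f -> lip_norm a (mult_op psi f) = lip_norm a f) <->
  (exists lambda : R[i], Normc.normc lambda = 1 /\ forall v : G, psi v = lambda).
Proof.
have little_sub : little_lip_space a `<=` X by case: hX => -> // f [].
split=> [isom | [c [c1 psiE]] f _].
  apply: (@isometric_multiplier_cst _ _ a) => [v|]; apply/isom/little_sub.
    exact: little_lip_spike.
  exact: little_lip_cst.
by rewrite (_ : psi = fun=> c) ?lip_norm_unimodular//; exact/funext.
Qed.
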